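(* Let $k=1$ and $\boldsymbol{C}=(c_0,c_1)=(0,1)$. Then $O_{\boldsymbol{C}}(n,m)=s_u(n,m)$ for all $n\in\mathbb{N}^+$ and $m\in\mathbb{N}$, where $s_u(n,m)$ denotes the unsigned Stirling numbers of the first kind.
   Context: Optimization set: let $U$ be a finite set of $d$-dimensional vectors and $\boldsymbol{R}=(R_1,\ldots,R_d)$ a vector of relations; write $(\boldsymbol{x},\boldsymbol{y})\in\boldsymbol{R}$ if $(x_i,y_i)\in R_i$ for all $i$. A subset $A\subseteq U$ is a majorization set of $U$ by $\boldsymbol{R}$ if for every $\boldsymbol{u}\in U$ there is $\boldsymbol{a}\in A$ with $(\boldsymbol{a},\boldsymbol{u})\in\boldsymbol{R}$ or $\boldsymbol{a}=\boldsymbol{u}$. An optimization set is a majorization set of minimum cardinality. $\boldsymbol{C}$ sequential optimization numbers: let $k,n\ge1$ and $\boldsymbol{C}=(c_0,\ldots,c_k)\in\{0,1\}^{k+1}$. Consider arrays $(a_{ij})_{1\le i\le n,\,1\le j\le k}$ such that for each $j$ the sequence $(a_{1j},\ldots,a_{nj})$ is a permutation of $\{1,\ldots,n\}$ (there are $n!^k$ such arrays). For each $j$ let $b_{ij}=(i,a_{ij})$, $U_j=\{b_{1j},\ldots,b_{nj}\}$, and let $S_j$ be the optimization set of $U_j$ by $(<,<)$ (so $b_{ij}\in S_j$ iff $a_{ij}<a_{i'j}$ for all $i'<i$). For each $i$ let $l_i$ be the number of $j\in\{1,\ldots,k\}$ with $b_{ij}\in S_j$; the index $i$ is selected iff $c_{l_i}=1$.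 Then $O_{\boldsymbol{C}}(n,m)$ is the number of arrays for which exactly $m$ indices $i\in\{1,\ldots,n\}$ are selected. *)

(* Defs.v *)
From mathcomp Require Import all_boot all_fingroup.

Set Implicit Arguments.
Unset Strict Implicit.
Unset Printing Implicit Defensive.

Section OptimizationSet.

Variables (d : nat) (T : finType).
Implicit Types (R : d.-tuple (rel T)) (U A : {set d.-tuple T}).

Definition vrel R (x y : d.-tuple T) : bool :=
  [forall i : 'I_d, tnth R i (tnth x i) (tnth y i)].

Definition majorization_set R U A : bool :=
  (A \subset U) &&
  [forall u in U, exists a in A, vrel R a u || (a == u)].

(* [U] itself is a majorization set, so the minimum is always attained.
   In general several majorization sets may have minimum cardinality and
   [arg min] selects one of them; it is unique when [vrel R] is a strict
   partial order. *)
Definition optimization_set R U : {set d.-tuple T} :=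
  [arg min_(A < U | majorization_set R U A) #|A|].

End OptimizationSet.

Section SequentialOptimizationNumbers.

Variables (k n : nat).

(* The column [a j] is a permutation of ['I_n], and [a_{ij}] is [a j i];
   rows and values are indexed from 0, and so are the columns. *)
Definition array := {ffun 'I_k -> 'S_n}.

Implicit Types (a : array) (i : 'I_n) (j : 'I_k).

Definition lt_ord : rel 'I_n := fun x y => x < y.

Definition point a i j : 2.-tuple 'I_n := [tuple i; a j i].

Definition points a j : {set 2.-tuple 'I_n} := [set point a i j | i : 'I_n].

Definition opt_points a j : {set 2.-tuple 'I_n} :=
  optimization_set [tuple lt_ord; lt_ord] (points a j).

Definition opt_count a i : nat :=
  #|[set j : 'I_k | point a i j \in opt_points a j]|.

(* [opt_count a i <= k], so the default value of [nth] is never used. *)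
Definition selected (C : k.+1.-tuple bool) a i : bool :=
  nth false C (opt_count a i).

Definition seq_opt_number (C : k.+1.-tuple bool) (m : nat) : nat :=
  #|[set a : array | #|[set i : 'I_n | selected C a i]| == m]|.

End SequentialOptimizationNumbers.

(* Unsigned Stirling number of the first kind: the permutations of [n]
   elements with exactly [m] cycles, fixed points included. *)
Definition stirling1u (n m : nat) : nat :=
  #|[set s : 'S_n | #|porbits s| == m]|.

(* Main.v *)
(** Deleting the last row of a permutation of [n.+1] elements leaves a
    permutation of [n] elements and a value [j]: it destroys a left-to-right
    minimum exactly when [j] is the least value.  Likewise every permutation of
    {0, ..., n} is uniquely the product of a transposition [(n j)] and a
    permutation fixing [n], and that product has one cycle more than the induced
    permutation of [n] elements exactly when [j = n].  Matching the [n.+1]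
    choices of [j] on both sides gives, by induction, a bijection carrying the
    number of left-to-right minima to the number of cycles. *)

Require Import Defs.
From mathcomp Require Import all_boot all_fingroup.

Set Implicit Arguments.
Unset Strict Implicit.
Unset Printing Implicit Defensive.

Import GroupScope.

(** * Optimization sets of strict partial orders *)

Section StrictOrderOptimization.

Variables (d : nat) (T : finType) (R : d.-tuple (rel T)).
Implicit Types (U A : {set d.-tuple T}).

Definition minimal_elements U : {set d.-tuple T} :=
  [set u in U | [forall v in U, ~~ vrel R v u]].

(** Nothing in [U] but a minimal element itself can majorize it. *)
Lemma minimal_elements_sub_majorization U A :
  majorization_set R U A -> minimal_elements U \subset A.
Proof.
case/andP=> /subsetP sAU /forall_inP majA; apply/subsetP=> u.
rewrite inE => /andP[uU /forall_inP minu].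
have /exists_inP[a aA /orP[Rau|/eqP<- //]] := majA u uU.
by have := minu a (sAU a aA); rewrite Rau.
Qed.

Hypotheses (Rirr : irreflexive (vrel R)) (Rtrans : transitive (vrel R)).

Lemma majorization_minimal_elements U :
  majorization_set R U (minimal_elements U).
Proof.
apply/andP; split; first by apply/subsetP=> u; rewrite inE => /andP[].
apply/forall_inP=> u uU; pose below v := [set w in U | vrel R w v].
have Pu : (u \in U) && (vrel R u u || (u == u)) by rewrite uU eqxx orbT.
(* Among the elements equal to or below [u], take [v] with the fewest elements below it: any [w]
   below [v] would have strictly fewer. *)
case: (@arg_minnP _ u (fun v => (v \in U) && (vrel R v u || (v == u)))
        (fun v => #|below v|) Pu) => v /andP[vU Rvu] minv.
apply/exists_inP; exists v => //; rewrite inE vU; apply/forall_inP=> w wU.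
apply/negP=> Rwv.
have Rwu : vrel R w u by case/orP: Rvu => [/(Rtrans Rwv) // | /eqP<-].
have := minv w; rewrite wU Rwu => /(_ isT); apply/negP; rewrite -ltnNge.
apply/proper_card/properP; split.
  apply/subsetP=> x; rewrite !inE => /andP[-> Rxw] /=.
  exact: Rtrans Rxw Rwv.
by exists w; rewrite !inE wU ?Rwv ?Rirr.
Qed.

Lemma optimization_set_minimal_elements U :
  optimization_set R U = minimal_elements U.
Proof.
have majU : majorization_set R U U.
  apply/andP; split=> //; apply/forall_inP=> u uU.
  by apply/exists_inP; exists u; rewrite // eqxx orbT.
rewrite /optimization_set; case: arg_minnP => // A majA minA.
apply/esym/eqP; rewrite eqEcard minimal_elements_sub_majorization //.
exact/minA/majorization_minimal_elements.
Qed.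

End StrictOrderOptimization.

(** Left-to-right minima; as [s] is injective, the weak inequality amounts to the strict one. *)
Definition ltr_min n (s : 'S_n) (i : 'I_n) : bool :=
  [forall i' : 'I_n, (i' < i) ==> (s i <= s i')].

Definition ltr_minima n (s : 'S_n) : {set 'I_n} := [set i | ltr_min s i].

(** * Selected indices as left-to-right minima *)

Section OptimalPoints.

Variables k n : nat.
Implicit Types (a : array k n) (i : 'I_n) (j : 'I_k).

Lemma vrel_lt_ord (x y : 2.-tuple 'I_n) :
  vrel [tuple @lt_ord n; @lt_ord n] x y =
  (tnth x ord0 < tnth y ord0) && (tnth x ord_max < tnth y ord_max).
Proof.
apply/forallP/andP=> [xy | [xy0 xy1] i].
  exact: conj (xy ord0) (xy ord_max).
case: (unliftP ord_max i) => [i'|] -> //.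
by rewrite (ord1 i') (_ : lift _ _ = ord0) //; exact/val_inj.
Qed.

Lemma mem_opt_points a i j :
  (point a i j \in opt_points a j) = ltr_min (a j) i.
Proof.
rewrite /opt_points optimization_set_minimal_elements; last 2 first.
- by move=> x; rewrite vrel_lt_ord !ltnn.
- move=> y x z; rewrite !vrel_lt_ord => /andP[xy0 xy1] /andP[yz0 yz1].
  by rewrite (ltn_trans xy0) ?(ltn_trans xy1).
have pointsP i' : point a i' j \in points a j by apply/imsetP; exists i'.
rewrite inE pointsP /=.
apply/forall_inP/forallP => [mini i' | mini _ /imsetP[i' _ ->]].
  apply/implyP=> lt_i'i; have := mini (point a i' j) (pointsP i').
  by rewrite vrel_lt_ord !(tnth_nth i) /= lt_i'i /= -leqNgt.
rewrite vrel_lt_ord !(tnth_nth i) /= negb_and -implybE -leqNgt.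
exact: mini.
Qed.

End OptimalPoints.

(** With a single column [opt_count] is 0 or 1, and the tuple sends these to [false] and [true]. *)
Lemma selected_ltr_min n (a : array 1 n) (i : 'I_n) :
  selected [tuple false; true] a i = ltr_min (a ord0) i.
Proof.
have -> : ltr_min (a ord0) i = (point a i ord0 \in opt_points a ord0).
  by rewrite mem_opt_points.
rewrite /selected /opt_count; case opt0: (_ \in opt_points a ord0).
  rewrite (_ : [set _ | _] = setT) ?cardsT ?card_ord //.
  by apply/setP=> j; rewrite !inE (ord1 j).
rewrite (_ : [set _ | _] = set0) ?cards0 //.
by apply/setP=> j; rewrite !inE (ord1 j).
Qed.

Lemma seq_opt_number_ltr_minima n m :
  @seq_opt_number 1 n [tuple false; true] m =
  #|[set s : 'S_n | #|ltr_minima s| == m]|.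
Proof.
pose col (s : 'S_n) : array 1 n := [ffun=> s].
have col_inj : injective col by move=> s t /ffunP/(_ ord0); rewrite !ffunE.
rewrite -(card_imset _ col_inj); apply: eq_card => a; rewrite inE.
have eq_sel : [set i | selected [tuple false; true] a i] = ltr_minima (a ord0).
  by apply/setP=> i; rewrite !inE selected_ltr_min.
have {2}-> : a = col (a ord0) by apply/ffunP=> j; rewrite ffunE (ord1 j).
by rewrite mem_imset // inE -eq_sel.
Qed.

(** * Two decompositions of the permutations of [n.+1] elements *)

Section LastRow.

Variable n : nat.
Implicit Types (p : 'I_n.+1 * 'S_n) (t : 'S_n) (j : 'I_n.+1).

Lemma card_ord_perm : #|{: 'I_n.+1 * 'S_n}| = #|{: 'S_n.+1}|.
Proof. by rewrite card_prod card_ord !card_Sn factS. Qed.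

Lemma lift_perm_inj (i j : 'I_n.+1) : injective (@lift_perm n i j).
Proof.
move=> s t eq_st; apply/permP=> x; apply: (@lift_inj _ j).
by rewrite -!(lift_perm_lift i) eq_st.
Qed.

Definition append_row p : 'S_n.+1 := lift_perm ord_max p.1 p.2.

Lemma append_row_bij : bijective append_row.
Proof.
apply: inj_card_bij; last by rewrite card_ord_perm.
case=> [j s] [j' t] /= eq_st.
have eq_j : j = j'.
  by rewrite -(lift_perm_id ord_max j s) [lift_perm _ _ _]eq_st lift_perm_id.
by move: eq_st; rewrite /append_row eq_j /= => /lift_perm_inj->.
Qed.

(** Since [lift p.1] is increasing and the last row precedes no other, the earlier rows keep their
    status; the last row is a minimum only with the least value. *)
Lemma card_ltr_minima_append_row p :
  #|ltr_minima (append_row p)| = #|ltr_minima p.2| + (p.1 == ord0).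
Proof.
case: p => j t; rewrite /append_row /=.
set s := lift_perm ord_max j t.
have s_max : ltr_min s ord_max = (j == ord0).
  apply/forallP/eqP=> [mins | j0 i]; last first.
    by rewrite lift_perm_id j0 implybT.
  apply/val_inj/eqP; rewrite -leqn0 /= leqNgt; apply/negP=> j_gt0.
  (* Test the row holding the value 0: if [j] is positive, that row cannot precede the last one, so
     it is the last one, forcing [j] to be 0. *)
  have := mins (s^-1 ord0); rewrite lift_perm_id permKV leqn0.
  rewrite (gtn_eqF j_gt0) implybF -leqNgt => max_le.
  have /(congr1 s) : s^-1 ord0 = ord_max.
    by apply/val_inj/eqP; rewrite eqn_leq max_le -ltnS ltn_ord.
  by rewrite permKV [RHS]lift_perm_id => j0; rewrite -j0 in j_gt0.
have s_lift (i : 'I_n) : ltr_min s (lift ord_max i) = ltr_min t i.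
  have le_lift (x y : 'I_n) : (lift j x <= lift j y) = (x <= y).
    exact: leq_bump2.
  apply/forallP/forallP => mint i'.
    have := mint (lift ord_max i'); rewrite !lift_perm_lift !lift_max le_lift.
    exact.
  case: (unliftP ord_max i') => [x|] ->.
    by rewrite !lift_perm_lift !lift_max le_lift.
  by rewrite lift_max ltnNge ltnW.
rewrite (cardsD1 ord_max (ltr_minima s)) inE s_max addnC.
rewrite -(card_imset (ltr_minima t) (@lift_inj _ ord_max)).
congr (_ + _)%N; apply: eq_card => i; rewrite !inE.
case: (unliftP ord_max i) => [x|] ->.
  by rewrite eq_sym neq_lift mem_imset ?inE ?s_lift //; exact: lift_inj.
rewrite eqxx; apply/esym/imsetP=> -[x _] /eqP.
by rewrite (negPf (neq_lift _ _)).
Qed.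

(** Products act left to right, so [ord_max] is inserted right after [p.1] in its cycle, or stays
    fixed if [p.1] is [ord_max]. *)
Definition insert_in_cycle p : 'S_n.+1 :=
  tperm ord_max p.1 * lift_perm ord_max ord_max p.2.

Lemma insert_in_cycle_bij : bijective insert_in_cycle.
Proof.
apply: inj_card_bij; last by rewrite card_ord_perm.
(* Hence [p.1] is recovered as the preimage of [ord_max]. *)
have insertE p : insert_in_cycle p p.1 = ord_max.
  by rewrite permM tpermR lift_perm_id.
move=> p q eq_pq; have eq1 : p.1 = q.1.
  by apply: (@perm_inj _ (insert_in_cycle q)); rewrite insertE -eq_pq insertE.
case: p q eq1 eq_pq => [j s] [_ t] /= <-; rewrite /insert_in_cycle /=.
by move/mulgI/lift_perm_inj->.
Qed.

Lemma porbit_lift_perm t (i : 'I_n.+1) (x : 'I_n) :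
  porbit (lift_perm i i t) (lift i x) = lift i @: porbit t x.
Proof.
have iterE m : (lift_perm i i t ^+ m) (lift i x) = lift i ((t ^+ m) x).
  elim: m => [|m IHm]; first by rewrite !expg0 !perm1.
  by rewrite !expgSr !permM IHm lift_perm_lift.
apply/setP=> y; apply/porbitP/imsetP=> [[m ->] | [z /porbitP[m ->] ->]].
  by exists ((t ^+ m) x); rewrite ?iterE ?mem_porbit.
by exists m; rewrite iterE.
Qed.

Lemma porbit_lift_perm_id t (i : 'I_n.+1) :
  porbit (lift_perm i i t) i = [set i].
Proof.
apply/setP=> y; rewrite inE; apply/porbitP/eqP=> [[m ->] | ->]; last first.
  by exists 0; rewrite expg0 perm1.
by elim: m => [|m IHm]; rewrite ?expg0 ?perm1 // expgSr permM IHm lift_perm_id.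
Qed.

Lemma card_porbits_lift_perm t (i : 'I_n.+1) :
  #|porbits (lift_perm i i t)| = #|porbits t|.+1.
Proof.
have -> : porbits (lift_perm i i t) =
          [set i] |: [set lift i @: (A : {set 'I_n}) | A in porbits t].
  apply/setP=> B; apply/imsetP/setU1P.
    case=> y _ ->; case: (unliftP i y) => [x|] ->; last first.
      by left; rewrite porbit_lift_perm_id.
    by right; rewrite porbit_lift_perm !imset_f.
  case=> [-> | /imsetP[_ /imsetP[x _ ->] ->]].
    by exists i; rewrite ?porbit_lift_perm_id.
  by exists (lift i x); rewrite ?porbit_lift_perm.
rewrite cardsU1 card_imset; last exact/imset_inj/lift_inj.
case: imsetP => // -[A _ /setP/(_ i)].
rewrite inE eqxx => /esym/imsetP[x _] /eqP.
by rewrite (negPf (neq_lift _ _)).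
Qed.

(** Lifting adds the singleton cycle of [ord_max]; a nontrivial transposition merges it into the
    cycle of [p.1], while for [p.1 = ord_max] it survives. *)
Lemma card_porbits_insert_in_cycle p :
  #|porbits (insert_in_cycle p)| = #|porbits p.2| + (p.1 == ord_max).
Proof.
case: p => j t /=.
have := porbits_mul_tperm (lift_perm ord_max ord_max t) ord_max j.
rewrite porbit_sym porbit_lift_perm_id inE card_porbits_lift_perm.
rewrite -/(insert_in_cycle (j, t)) (eq_sym ord_max).
by case: eqP => _ /=; rewrite ?addn0 ?addn1 ?addn2 // => -[].
Qed.

End LastRow.

(** * Equidistribution of left-to-right minima and cycles *)

Lemma ltr_minima_porbits_bij n :
  exists2 h : 'S_n -> 'S_n, bijective h &
    forall s, #|porbits (h s)| = #|ltr_minima s|.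
Proof.
elim: n => [|n [h h_bij hE]].
  exists id => [|s]; first by exists id.
  have card0 (T : finType) (A : {set T}) : #|T| = 0 -> #|A| = 0.
    by move=> T0; apply/eqP; rewrite -leqn0 -T0 max_card.
  rewrite (card0 _ (ltr_minima s)) ?card_ord //.
  by apply/eqP; rewrite -leqn0 (leq_trans (leq_imset_card _ _)) ?card_ord.
have [rows appK rowsK] := append_row_bij n.
(* [rev_ord] sends [ord0], which creates a minimum, to [ord_max], which creates a cycle. *)
pose match_rows (p : 'I_n.+1 * 'S_n) := (rev_ord p.1, h p.2).
have match_bij : bijective match_rows.
  case: h_bij => g hK gK; exists (fun p => (rev_ord p.1, g p.2)) => -[j s];
    by rewrite /match_rows /= rev_ordK ?hK ?gK.
exists (@insert_in_cycle n \o match_rows \o rows) => [|s].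
  apply: bij_comp (Bijective rowsK appK).
  exact: bij_comp (insert_in_cycle_bij n) match_bij.
rewrite -{2}(rowsK s) /= card_porbits_insert_in_cycle.
rewrite card_ltr_minima_append_row.
congr (_ + nat_of_bool _); first exact: hE.
rewrite (inv_eq (@rev_ordK _)).
by congr (_ == _); apply/val_inj; rewrite /= subnn.
Qed.

Theorem lemma2p3 (n m : nat) (n_gt0 : 0 < n) :
  @seq_opt_number 1 n [tuple false; true] m = stirling1u n m.
Proof.
rewrite seq_opt_number_ltr_minima /stirling1u.
have [h h_bij hE] := ltr_minima_porbits_bij n.
rewrite -[RHS](on_card_preimset (onW_bij _ h_bij)).
by apply: eq_card => s; rewrite !inE hE.
Qed.
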